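(* Let $\varphi,\psi\in L^2(\mathscr G)$ be such that the systems $\mathcal E^\Gamma(\varphi)$ and $\mathcal E^\Gamma(\psi)$ are Bessel. Then the following are true. (i) Assume $[\varphi,\varphi](\alpha)[\psi,\psi](\alpha)=0$ for a.e. $\alpha\in\widehat\Gamma$. Then $[\varphi,\psi](\alpha)=0$ for a.e. $\alpha$, and hence $\mathcal E^\Gamma(\psi)$ is $\mathcal S^\Gamma(\varphi)$-subspace orthogonal to $\mathcal E^\Gamma(\varphi)$. (ii) If $\mathcal E^\Gamma(\psi)$ is $\mathcal S^\Gamma(\varphi)$-subspace orthogonal to $\mathcal E^\Gamma(\varphi)$, then $\mathcal E^\Gamma(\tilde\psi)$ is also $\mathcal S^\Gamma(\varphi)$-subspace orthogonal to $\mathcal E^\Gamma(\varphi)$ for all $\tilde\psi\in\mathcal S^\Gamma(\psi)$. (iii) If $\mathcal S^\Gamma(\psi)=\mathcal S^\Gamma(\varphi)$ and $\mathcal E^\Gamma(\psi)$ is $\mathcal S^\Gamma(\varphi)$-subspace orthogonal to $\mathcal E^\Gamma(\varphi)$, then $\mathcal E^\Gamma(\varphi)$ is also $\mathcal S^\Gamma(\varphi)$-subspace orthogonal to $\mathcal E^\Gamma(\psi)$, and hence $\mathcal E^\Gamma(\psi)$ and $\mathcal E^\Gamma(\varphi)$ are an orthogonal pair. (iv) Assume $\mathcal S^\Gamma(\psi)=\mathcal S^\Gamma(\varphi)$. Then $\mathcal E^\Gamma(\psi)$ and $\mathcal E^\Gamma(\varphi)$ are an orthogonal pair if and only if $[\varphi,\varphi](\alpha)[\psi,\psi](\alpha)=0$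 for a.e. $\alpha\in\widehat\Gamma$. (v) If $(\operatorname{supp}\mathcal Z\varphi)\cap(\operatorname{supp}\mathcal Z\psi)$ has measure zero in $\widehat\Gamma$, then $\mathcal E^\Gamma(\psi)$ is $\mathcal S^\Gamma(\varphi)$-subspace orthogonal to $\mathcal E^\Gamma(\varphi)$, where $\operatorname{supp}\mathcal Z\varphi=\{\alpha\in\widehat\Gamma:\mathcal Z\varphi(\alpha)\ne0\}$ denotes the support of the map $\mathcal Z\varphi:\widehat\Gamma\to L^2(\Gamma\backslash\mathscr G)$.
   Context: $\mathscr G$ is a second countable locally compact group (not necessarily abelian) with left Haar measure, $\Gamma$ is a closed discrete abelian subgroup with counting measure, and $\widehat\Gamma$ is its (compact) dual group with normalized Haar measure. $(L_\gamma f)(x)=f(\gamma^{-1}x)$, $\mathcal E^\Gamma(\varphi)=\{L_\gamma\varphi\}_{\gamma\in\Gamma}$, $\mathcal S^\Gamma(\varphi)=\overline{\operatorname{span}}\,\mathcal E^\Gamma(\varphi)$. $\Gamma\backslash\mathscr G$ is the space of right cosets $\Gamma x$, $\Xi:\Gamma\backslash\mathscr G\to\mathscr G$ is a Borel section, and $\Gamma\backslash\mathscr G$ carries the measure with $\int_{\mathscr G}f=\int_{\Gamma\backslash\mathscr G}\sum_{\gamma\in\Gamma}f(\gamma\,\Xi(\Gamma x))\,d\mu_{\Gamma\backslash\mathscr G}(\Gamma x)$. The Zak transform $\mathcal Z:L^2(\mathscr G)\to L^2(\widehat\Gamma\times\Gamma\backslash\mathscr G)\cong L^2(\widehat\Gamma;L^2(\Gamma\backslash\mathscr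 G))$ is the unitary extension of $(\mathcal Zf)(\alpha,\Gamma x)=\sum_{\gamma\in\Gamma}f(\gamma\,\Xi(\Gamma x))\,\alpha(\gamma^{-1})$, $f\in L^1\cap L^2$; write $\mathcal Zf(\alpha)=\{\mathcal Zf(\alpha,\Gamma x)\}_{\Gamma x}$. The bracket is $[\psi,\varphi](\alpha)=\int_{\Gamma\backslash\mathscr G}\mathcal Z\psi(\alpha,\Gamma x)\overline{\mathcal Z\varphi(\alpha,\Gamma x)}\,d\mu_{\Gamma\backslash\mathscr G}(\Gamma x)$. A countable family $\{f_k\}$ in a Hilbert space $\mathcal H$ is Bessel if $\sum_k|\langle f,f_k\rangle|^2\le B\|f\|^2$ for all $f\in\mathcal H$ and some $B<\infty$. For a closed subspace $\mathcal K$ of $\mathcal H$ and a Bessel family $\{f_k\}$ in $\mathcal H$, a family $\{h_k\}$ is called $\mathcal K$-subspace orthogonal to $\{f_k\}$ if $\{h_k\}$ is Bessel in $\mathcal H$ and $\sum_k\langle f,h_k\rangle f_k=0$ for all $f\in\mathcal K$. Bessel families $\mathcal X=\{f_k\}$ and $\mathcal Y=\{g_k\}$ are an orthogonal pair if $\overline{\operatorname{span}}\,\mathcal X=\overline{\operatorname{span}}\,\mathcal Y$ and $\sum_k\langle f,g_k\rangle f_k=0$ for all $f$ in this common closed span.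
   Formalization: In (ii), the system of translates of ψ̃ need not be Bessel (e.g. φ=0, ψ̃ with unbounded multiplier), so the formal claim gives the identity Σ⟨f,L_γψ̃⟩L_γφ=0 on S(φ) for every ψ̃ in S(ψ), and full subspace orthogonality when that system is Bessel. *)

(* Defs.v *)
From HB Require Import structures.
From mathcomp Require Import all_boot all_order all_algebra.
From mathcomp Require Import all_classical all_reals all_analysis.
From mathcomp Require Import measurable_realfun finmap complex.
Import Order.TTheory GRing.Theory Num.Theory.
Import numFieldNormedType.Exports.

Set Implicit Arguments.
Unset Strict Implicit.
Unset Printing Implicit Defensive.

Local Open Scope classical_set_scope.
Local Open Scope ring_scope.

(** * Topological groups and Haar measure *)

HB.mixin Record isTopGroup G of Topological G & Group G := {
  mulg_continuous : continuous (fun z : G * G => (z.1 * z.2)%g);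
  invg_continuous : continuous (fun x : G => (x^-1)%g)
}.

(* The base point is arbitrary and plays no role; it is there because the
   library only equips pointed types with generated sigma-algebras. *)
#[short(type="topGroupType")]
HB.structure Definition TopGroup :=
  {G of Pointed G & Topological G & Group G & isTopGroup G}.

Notation borel T := (g_sigma_algebraType (@open T)).

(* Radon regularity is not listed: on a second countable locally compact
   Hausdorff space it holds for every Borel measure finite on compact sets. *)
Definition left_haar (R : realType) (G : topGroupType)
    (mu : set (borel G) -> \bar R) : Prop :=
  [/\ (0 < mu setT)%E,
      (forall K : set G, compact K -> (mu K < +oo)%E) &
      forall (g : G) (A : set (borel G)), measurable A ->
        mu [set (g * x)%g | x in (A : set G)] = mu A].

(** * The subgroup and its coset space *)

Section Subgroup.
Context {G : topGroupType} (Gam : groupClosed G).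

Definition subgrp := {x : G | x \in Gam}.

HB.instance Definition _ := SubChoice.on subgrp.

Fact subgrp_closed : group_closed Gam.
Proof. by split; [exact: gpred1 | exact: gpredF]. Qed.

HB.instance Definition _ :=
  SubChoice_isSubGroup.Build G (fun x => x \in Gam) subgrp subgrp_closed.

Definition closed_discrete_abelian : Prop :=
  [/\ closed [set` Gam],
      [set` Gam] `<=` isolated [set` Gam] &
      forall a b : subgrp, commute a b].

(* x y^-1 \in Gam, i.e. Gam x = Gam y. *)
Definition coset_rel (x y : G) : bool := (x / y)%g \in Gam.

Fact coset_rel_refl : reflexive coset_rel.
Proof. by move=> x; rewrite /coset_rel divgg gpred1. Qed.

Fact coset_rel_sym : symmetric coset_rel.
Proof. by move=> x y; rewrite /coset_rel gpredFC. Qed.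

Fact coset_rel_trans : transitive coset_rel.
Proof.
move=> y x z xy yz; have := gpredM _ _ xy yz.
by rewrite mulgA mulgVK.
Qed.

Canonical coset_equiv :=
  EquivRel coset_rel coset_rel_refl coset_rel_sym coset_rel_trans.

(* Gam \ G with the quotient topology. *)
Definition coset_space := quotient_topology {eq_quot coset_equiv}%qT.
HB.instance Definition _ := Quotient.on coset_space.
HB.instance Definition _ := PointedTopological.on coset_space.

Definition coset (x : G) : coset_space := (\pi_coset_space x)%qT.

End Subgroup.

Arguments subgrp {G} Gam.
Arguments coset_space {G} Gam.

(** * The dual group of a discrete group *)

Section Dual.
Context (R : realType) (A : groupType).
Local Notation C := (R[i] : numFieldType).

(* A carries the discrete topology, so continuity of characters is vacuous. *)
Definition is_character (chi : A -> C) : Prop :=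
  (forall a b : A, chi (a * b)%g = chi a * chi b) /\
  (forall a : A, `|chi a| = 1).

Definition char_sig := {chi : A -> C | `[< is_character chi >]}.
HB.instance Definition _ := SubChoice.on char_sig.

Definition char_fun (chi : char_sig) : {ptws A -> C} := val chi.

(* Compact subsets of a discrete group are finite, so the compact-open
   topology is the topology of pointwise convergence. *)
Definition dual := initial_topology char_fun.
HB.instance Definition _ := Topological.on dual.

Definition ev (chi : dual) (a : A) : C := char_fun chi a.

Fact evM chi a b : ev chi (a * b)%g = ev chi a * ev chi b.
Proof. by case: chi => /= f pf; have /asboolP[+ _] := pf; exact. Qed.

Fact ev_norm chi a : `|ev chi a| = 1.
Proof. by case: chi => /= f pf; have /asboolP[_ +] := pf; exact. Qed.

Fact ev1 chi : ev chi 1%g = 1.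
Proof.
have n0 : ev chi 1%g != 0 by rewrite -normr_gt0 ev_norm.
by apply: (mulfI n0); rewrite -evM mulg1 mulr1.
Qed.

Definition mk_dual (f : A -> C) (pf : is_character f) : dual :=
  exist _ f (asboolT pf).

Fact one_char : is_character (fun _ => 1).
Proof. by split=> *; rewrite ?mulr1 ?normr1. Qed.

Fact mul_char (x y : dual) : is_character (fun a => ev x a * ev y a).
Proof.
by split=> *; rewrite ?evM ?normrM ?ev_norm ?mulr1// mulrACA.
Qed.

Fact inv_char (x : dual) : is_character (fun a => ev x (a^-1)%g).
Proof. by split=> *; rewrite ?ev_norm// invgM evM mulrC. Qed.

Let oned := mk_dual one_char.
Let muld x y := mk_dual (mul_char x y).
Let invd x := mk_dual (inv_char x).

Fact ev_inj (x y : dual) : ev x =1 ev y -> x = y.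
Proof. by move=> xy; apply: val_inj; exact/funext. Qed.

Fact muldA : associative muld.
Proof. by move=> x y z; apply: ev_inj => a; exact: mulrA. Qed.
Fact mul1d : left_id oned muld.
Proof. by move=> x; apply: ev_inj => a; exact: mul1r. Qed.
Fact muld1 : right_id oned muld.
Proof. by move=> x; apply: ev_inj => a; exact: mulr1. Qed.
Fact mulVd : left_inverse oned invd muld.
Proof.
by move=> x; apply: ev_inj => a; rewrite [LHS](esym (evM _ _ _)) mulVg ev1.
Qed.
Fact muldV : right_inverse oned invd muld.
Proof.
by move=> x; apply: ev_inj => a; rewrite [LHS](esym (evM _ _ _)) mulgV ev1.
Qed.

HB.instance Definition _ := isPointed.Build dual oned.
HB.instance Definition _ :=
  isGroup.Build dual muldA mul1d muld1 mulVd muldV.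

Fact ev_continuous (a : A) : continuous (fun x : dual => ev x a).
Proof.
move=> x; apply: (@continuous_comp _ _ _ (char_fun : dual -> _) (proj a)).
  exact: initial_continuous.
exact: proj_continuous.
Qed.

Fact dual_continuous (X : topologicalType) (f : X -> dual) :
  (forall a, continuous (fun x => ev (f x) a)) -> continuous f.
Proof.
move=> cf; apply: continuous_comp_initial => x; apply/cvg_sup => a U.
move=> [V] [[W] oW <-] Wfx WU; apply: (filterS WU).
by apply: (cf a x); exact: open_nbhs_nbhs.
Qed.

Fact dual_mul_continuous : continuous (fun z : dual * dual => (z.1 * z.2)%g).
Proof.
apply: dual_continuous => a z.
apply: (@continuousM C _ (fun z : dual * dual => ev z.1 a)
                         (fun z : dual * dual => ev z.2 a)).
  apply: (@continuous_comp _ _ _ fst (ev^~ a)); first exact: cvg_fst.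
  exact: ev_continuous.
apply: (@continuous_comp _ _ _ snd (ev^~ a)); first exact: cvg_snd.
exact: ev_continuous.
Qed.

Fact dual_inv_continuous : continuous (fun x : dual => (x^-1)%g).
Proof. by apply: dual_continuous => a; exact: ev_continuous. Qed.

HB.instance Definition _ :=
  isTopGroup.Build dual dual_mul_continuous dual_inv_continuous.

End Dual.

(** * Complex L^2 spaces *)

(* The norm of R[i] is R[i]-valued; this is the same number in R. *)
Definition cnorm (R : realType) (z : R[i]) : R := complex.Re `|z|.

Section L2.
Context {R : realType} {d : measure_display} {T : measurableType d}.
Variable mu : {measure set T -> \bar R}.
Implicit Types f g : T -> R[i].

Definition cmeasurable f : Prop :=
  measurable_fun setT (fun x => complex.Re (f x)) /\
  measurable_fun setT (fun x => complex.Im (f x)).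

Definition cintegral f : R[i] :=
  ((\int[mu]_x complex.Re (f x))%R +i* (\int[mu]_x complex.Im (f x))%R)%C.

Definition sqnorm f : \bar R := (\int[mu]_x (cnorm (f x) ^+ 2)%:E)%E.

(* Elements of L^2 are represented by functions; every notion below is
   invariant under modification on a null set. *)
Definition L1 f : Prop :=
  cmeasurable f /\ (\int[mu]_x (cnorm (f x))%:E < +oo)%E.

Definition L2 f : Prop := cmeasurable f /\ (sqnorm f < +oo)%E.

Definition inner f g : R[i] := cintegral (fun x => f x * (g x)^*%C).

End L2.

(* Unconditional summability of a family: F sums to s with respect to the
   size function N when the finite partial sums converge to s along the
   directed set of finite subsets of the index set. *)
Definition sums_to (R : realType) (I : choiceType) (V : zmodType)
    (N : V -> \bar R) (F : I -> V) (s : V) : Prop :=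
  forall e : R, 0 < e -> exists A0 : {fset I}, forall A : {fset I},
    (A0 `<=` A)%fset -> (N (\sum_(k <- A) F k - s)%R < e%:E)%E.

(** * Families of vectors in L^2 *)

Section Frames.
Context {R : realType} {d : measure_display} {T : measurableType d}.
Context (mu : {measure set T -> \bar R}) {I : choiceType}.
Implicit Types F H : I -> T -> R[i].

Definition bessel F : Prop :=
  (forall k, L2 mu (F k)) /\
  exists B : R, forall f, L2 mu f ->
    (\esum_(k in [set: I]) (cnorm (inner mu f (F k)) ^+ 2)%:E
       <= B%:E * sqnorm mu f)%E.

Definition closed_span F : set (T -> R[i]) :=
  [set f | L2 mu f /\ forall e : R, 0 < e ->
    exists (A : {fset I}) (c : I -> R[i]),
      (sqnorm mu (f - \sum_(k <- A) (fun x => c k * F k x))%R < e%:E)%E].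

(* \sum_k <f, H k> F k = 0 in L^2 for all f in K. *)
Definition annihilates (K : set (T -> R[i])) F H : Prop :=
  forall f, K f ->
    sums_to (sqnorm mu) (fun k x => inner mu f (H k) * F k x) 0.

(* H is K-subspace orthogonal to F. *)
Definition subspace_orthogonal (K : set (T -> R[i])) H F : Prop :=
  bessel H /\ annihilates K F H.

Definition orthogonal_pair F H : Prop :=
  [/\ bessel F, bessel H, closed_span F = closed_span H &
      annihilates (closed_span F) F H].

End Frames.

(** * Translates, Zak transform, bracket *)

Section Zak.
Context {R : realType} {G : topGroupType} {Gam : groupClosed G}.

(* \mathcal E^\Gamma(phi) *)
Definition translates (phi : G -> R[i]) : subgrp Gam -> G -> R[i] :=
  fun gam x => phi ((val gam)^-1 * x)%g.

Definition borel_section (Xi : coset_space Gam -> G) : Prop :=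
  measurable_fun setT (Xi : borel (coset_space Gam) -> borel G) /\
  forall q, coset Gam (Xi q) = q.

Context (mu : {measure set (borel G) -> \bar R})
  (nu : {sigma_finite_measure set (borel (coset_space Gam)) -> \bar R})
  (P : probability (borel (dual R (subgrp Gam))) R)
  (Xi : coset_space Gam -> G).

(* Stated for nonnegative functions (Tonelli form), where no integrability
   is needed for either side to make sense. *)
Definition weil_formula : Prop :=
  forall f : borel G -> \bar R, measurable_fun setT f ->
    (forall x, 0 <= f x)%E ->
    (\int[mu]_x f x =
     \int[nu]_q \esum_(gam in [set: subgrp Gam]) f (val gam * Xi q)%g)%E.

Local Notation DQ :=
  (borel (dual R (subgrp Gam)) * borel (coset_space Gam))%type.

(* Z is the unitary extension to L^2(G) of the series formula on L^1 n L^2;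
   as on the L^2 side, values of Z are functions up to null sets. *)
Definition zak_transform (Z : (G -> R[i]) -> DQ -> R[i]) : Prop :=
  [/\ (forall f, L2 mu f -> L2 (P \x nu)%E (Z f)),
      (forall (a : R[i]) f g, L2 mu f -> L2 mu g ->
         {ae (P \x nu)%E, forall p,
            Z (fun x => a * f x + g x) p = a * Z f p + Z g p}),
      (forall f, L2 mu f -> sqnorm (P \x nu)%E (Z f) = sqnorm mu f),
      (forall F, L2 (P \x nu)%E F -> exists2 f, L2 mu f &
         {ae (P \x nu)%E, forall p, Z f p = F p}) &
      forall f, L1 mu f -> L2 mu f ->
        {ae (P \x nu)%E, forall p,
           sums_to (fun z => (cnorm z)%:E)
             (fun gam : subgrp Gam =>
                f (val gam * Xi p.2)%g * ev p.1 (gam^-1)%g)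
             (Z f p)}].

(* [psi, phi](al), where the arguments are Z psi and Z phi. *)
Definition bracket (Zpsi Zphi : DQ -> R[i])
    (al : borel (dual R (subgrp Gam))) : R[i] :=
  cintegral nu (fun q => Zpsi (al, q) * (Zphi (al, q))^*%C).

(* The al for which Z phi al is nonzero as an element of L^2(Gam \ G). *)
Definition zak_supp (Zphi : DQ -> R[i]) : set (borel (dual R (subgrp Gam))) :=
  [set al | ~ {ae nu, forall q, Zphi (al, q) = 0}].

End Zak.

Arguments translates {R G} Gam phi.

(* Main.v *)
Require Import Defs.
From mathcomp Require Import all_boot all_order all_algebra.
From mathcomp Require Import all_classical all_reals all_analysis.
From mathcomp Require Import measurable_realfun finmap complex.
From mathcomp Require Import ring lra.
Import Order.TTheory GRing.Theory Num.Theory.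
Import numFieldNormedType.Exports.

Local Open Scope classical_set_scope.
Local Open Scope ring_scope.

(* Write c_k = <phi, L_k psi>.  If the sums h_A = sum_(k in A) c_k L_k phi tend
   to 0, then so do the k_A = sum_(k in A) conj(c_k) L_(k^-1) phi: since Gamma is
   abelian, h_A and k_A have the same Gram sums and hence the same norm.  But
   <k_A, psi> = sum_(k in A) |c_k|^2, so every c_k vanishes.  Thus subspace
   orthogonality of E(psi) to E(phi) forces S(phi) and S(psi) to be orthogonal,
   which gives (ii), (iii) and one half of (iv); no Fourier analysis on the dual
   group is needed.

   For (i), (v) and the other half of (iv), almost every fibre of Z phi or of
   Z psi vanishes, so [phi, psi] = 0 a.e.  As Z intertwines L_k with
   multiplication by alpha(k^-1), c_k is a Fourier coefficient of [phi, psi] by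
   Fubini, hence 0. *)

Set Implicit Arguments.
Unset Strict Implicit.
Unset Printing Implicit Defensive.

(** * Complex arithmetic through real and imaginary parts, and the real-valued modulus *)

Section Complex.
Context {R : realType}.
Implicit Types x y : R[i].

Lemma ReD x y : complex.Re (x + y) = complex.Re x + complex.Re y.
Proof. by case: x y => ? ? []. Qed.

Lemma ImD x y : complex.Im (x + y) = complex.Im x + complex.Im y.
Proof. by case: x y => ? ? []. Qed.

Lemma ReM x y : complex.Re (x * y) =
  complex.Re x * complex.Re y - complex.Im x * complex.Im y.
Proof. by case: x y => ? ? []. Qed.

Lemma ImM x y : complex.Im (x * y) =
  complex.Re x * complex.Im y + complex.Im x * complex.Re y.
Proof. by case: x y => ? ? []. Qed.

Lemma Re_conj x : complex.Re x^*%C = complex.Re x.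
Proof. by case: x. Qed.

Lemma Im_conj x : complex.Im x^*%C = - complex.Im x.
Proof. by case: x. Qed.

Definition cE := (ReD, ImD, ReM, ImM, Re_conj, Im_conj).

Lemma complex_eq x y :
  complex.Re x = complex.Re y -> complex.Im x = complex.Im y -> x = y.
Proof. by case: x y => ? ? [] ? ? /= -> ->. Qed.

Lemma cnorm_ge0 x : 0 <= cnorm x.
Proof. by case: x => a b; rewrite /cnorm /= sqrtr_ge0. Qed.

Lemma sqr_cnorm x : cnorm x ^+ 2 = complex.Re x ^+ 2 + complex.Im x ^+ 2.
Proof. by case: x => a b; rewrite /cnorm /= sqr_sqrtr// addr_ge0// sqr_ge0. Qed.

Lemma cnormE x : cnorm x = Num.sqrt (complex.Re x ^+ 2 + complex.Im x ^+ 2).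
Proof. by case: x. Qed.

Lemma cnormC x : (cnorm x)%:C%C = `|x|.
Proof. by case: x. Qed.

Lemma cnormM x y : cnorm (x * y) = cnorm x * cnorm y.
Proof. by apply: complexI; rewrite rmorphM /= !cnormC normrM. Qed.

Lemma ler_cnormD x y : cnorm (x + y) <= cnorm x + cnorm y.
Proof. by rewrite -lecR rmorphD /= !cnormC ler_normD. Qed.

Lemma cnormN x : cnorm (- x) = cnorm x.
Proof. by apply: complexI; rewrite !cnormC normrN. Qed.

Lemma cnorm0 : cnorm (0 : R[i]) = 0.
Proof. by rewrite cnormE /= expr0n /= addr0 sqrtr0. Qed.

Lemma cnorm0_eq0 x : cnorm x = 0 -> x = 0.
Proof. by move=> x0; apply/eqP; rewrite -normr_eq0 -cnormC x0. Qed.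

Lemma cnorm_unit x : `|x| = 1 -> cnorm x = 1.
Proof. by rewrite /cnorm => ->. Qed.

Lemma sqr_cnormD x y : cnorm (x + y) ^+ 2 <= 2 * (cnorm x ^+ 2 + cnorm y ^+ 2).
Proof.
rewrite !sqr_cnorm !cE.
have := sqr_ge0 (complex.Re x - complex.Re y).
have := sqr_ge0 (complex.Im x - complex.Im y).
by rewrite !sqrrB !sqrrD; lra.
Qed.

Lemma mulc_conj x : x * x^*%C = (cnorm x ^+ 2)%:C%C.
Proof.
by apply: complex_eq; rewrite !cE /= ?sqr_cnorm; ring.
Qed.

End Complex.

(** * Measurability of complex-valued functions *)

Section Measurable.
Context {R : realType} {d : measure_display} {T : measurableType d}.
Implicit Types f g : T -> R[i].

Lemma cmeasurable_cst (c : R[i]) : cmeasurable (fun _ : T => c).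
Proof. by split; exact: measurable_cst. Qed.

Lemma cmeasurableD f g :
  cmeasurable f -> cmeasurable g -> cmeasurable (fun x => f x + g x).
Proof.
move=> [rf imf] [rg ig]; split.
- by under eq_fun do rewrite ReD; exact: measurable_funD.
- by under eq_fun do rewrite ImD; exact: measurable_funD.
Qed.

Lemma cmeasurableM f g :
  cmeasurable f -> cmeasurable g -> cmeasurable (fun x => f x * g x).
Proof.
move=> [rf imf] [rg ig]; split.
- by under eq_fun do rewrite ReM; apply: measurable_funB; exact: measurable_funM.
- by under eq_fun do rewrite ImM; apply: measurable_funD; exact: measurable_funM.
Qed.

Lemma cmeasurable_conj f : cmeasurable f -> cmeasurable (fun x => (f x)^*%C).
Proof.
move=> [rf imf]; split.
- by under eq_fun do rewrite Re_conj.
- by under eq_fun do rewrite Im_conj; exact: measurableT_comp.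
Qed.

Lemma measurable_sqr_cnorm f :
  cmeasurable f -> measurable_fun setT (fun x => cnorm (f x) ^+ 2).
Proof.
move=> [rf imf]; under eq_fun do rewrite sqr_cnorm.
by apply: measurable_funD; exact: measurable_funX.
Qed.

Lemma measurable_cnorm f :
  cmeasurable f -> measurable_fun setT (fun x => cnorm (f x)).
Proof.
move=> mf; have -> : (fun x => cnorm (f x)) =
    (fun x => Num.sqrt (cnorm (f x) ^+ 2)).
  by apply/funext => x; rewrite sqrtr_sqr ger0_norm// cnorm_ge0.
apply: (measurableT_comp (f := @Num.sqrt R)); last exact: measurable_sqr_cnorm.
exact: continuous_measurable_fun (@sqrt_continuous R).
Qed.

End Measurable.

(** * Linearity and integrability for the complex integral *)

Section Cintegral.
Context {R : realType} {d : measure_display} {T : measurableType d}.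
Variable mu : {measure set T -> \bar R}.
Implicit Types f g h : T -> R[i].

Definition cintegrable f : Prop :=
  mu.-integrable setT (fun x => (complex.Re (f x))%:E) /\
  mu.-integrable setT (fun x => (complex.Im (f x))%:E).

Lemma cintegralD f g : cintegrable f -> cintegrable g ->
  cintegral mu (fun x => f x + g x) = cintegral mu f + cintegral mu g.
Proof.
move=> [rf imf] [rg ig]; apply: complex_eq; rewrite !cE /=.
- by under eq_Rintegral do rewrite ReD; exact: RintegralD.
- by under eq_Rintegral do rewrite ImD; exact: RintegralD.
Qed.

Lemma cintegralZ (a : R[i]) f : cintegrable f ->
  cintegral mu (fun x => a * f x) = a * cintegral mu f.
Proof.
move=> [rf imf].
have i1 (c : R) (u : T -> R) : mu.-integrable setT (fun x => (u x)%:E) ->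
    mu.-integrable setT (EFin \o (fun x => c * u x)).
  move=> iu; have := integrableZl measurableT c iu.
  by apply: eq_integrable => // x _ /=; rewrite EFinM.
apply: complex_eq; rewrite !cE /=.
- under eq_Rintegral do rewrite ReM.
  by rewrite RintegralB//; [rewrite !RintegralZl|exact: i1|exact: i1].
- under eq_Rintegral do rewrite ImM.
  by rewrite RintegralD//; [rewrite !RintegralZl|exact: i1|exact: i1].
Qed.

Lemma cintegral_conj f : cintegrable f ->
  cintegral mu (fun x => (f x)^*%C) = (cintegral mu f)^*%C.
Proof.
move=> [rf imf]; apply: complex_eq; rewrite !cE /=.
- by apply: eq_Rintegral => x _; rewrite Re_conj.
- under eq_Rintegral do rewrite Im_conj -mulN1r.
  by rewrite RintegralZl// mulN1r.
Qed.

Lemma L2_integrable f : L2 mu f ->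
  mu.-integrable setT (fun x => (cnorm (f x) ^+ 2)%:E).
Proof.
move=> [mf foo]; apply/integrableP; split.
  by apply/measurable_EFinP; exact: measurable_sqr_cnorm.
by under eq_integral do rewrite gee0_abs ?lee_fin ?sqr_ge0//.
Qed.

(** Expanding the squares of sums and differences of coordinates bounds both parts of the product by
    [cnorm x ^+ 2 + cnorm y ^+ 2], which is integrable when both functions are in L^2. *)
Lemma cintegrable_mul f g : L2 mu f -> L2 mu g ->
  cintegrable (fun x => f x * (g x)^*%C).
Proof.
move=> f2 g2; have [mf _] := f2; have [mg _] := g2.
have [mr mi] := cmeasurableM mf (cmeasurable_conj mg).
have fg := integrableD measurableT (L2_integrable f2) (L2_integrable g2).
have bnd (x y : R[i]) : `|complex.Re (x * y^*%C)| <= cnorm x ^+ 2 + cnorm y ^+ 2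
    /\ `|complex.Im (x * y^*%C)| <= cnorm x ^+ 2 + cnorm y ^+ 2.
  rewrite !sqr_cnorm !cE; case: x y => [a b] [c d'] /=.
  have sq (u v : R) := (sqr_ge0 (u - v), sqr_ge0 (u + v)).
  have := (sq a c, sq b d', sq a d', sq b c).
  rewrite !sqrrB !sqrrD => -[[[[? ?] [? ?]] [? ?]] [? ?]].
  by rewrite !ler_norml; split; apply/andP; split; lra.
split; apply: (le_integrable measurableT _ _ fg);
  try (by apply/measurable_EFinP); move=> x _ /=;
  rewrite lee_fin [leRHS]ger0_norm ?addr_ge0 ?sqr_ge0//.
- by have [] := bnd (f x) (g x).
- by have [] := bnd (f x) (g x).
Qed.

End Cintegral.

(** * L^2 as a semi-inner-product space of functions *)

Section L2space.
Context {R : realType} {d : measure_display} {T : measurableType d}.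
Variable mu : {measure set T -> \bar R}.
Implicit Types f g h : T -> R[i].

Lemma sqnorm_ge0 f : (0 <= sqnorm mu f)%E.
Proof. by apply: integral_ge0 => x _; rewrite lee_fin sqr_ge0. Qed.

Lemma sqnormZ (a : R[i]) f : cmeasurable f ->
  sqnorm mu (fun x => a * f x) = ((cnorm a ^+ 2)%:E * sqnorm mu f)%E.
Proof.
move=> mf; rewrite /sqnorm -ge0_integralZl ?lee_fin ?sqr_ge0//.
- by apply: eq_integral => x _; rewrite cnormM exprMn EFinM.
- by apply/measurable_EFinP; exact: measurable_sqr_cnorm.
- by move=> x _; rewrite lee_fin sqr_ge0.
Qed.

(** Integrates the pointwise bound [sqr_cnormD]. The factor 2 stands in for Minkowski's inequality,
    so that estimates stay with squared norms in the extended reals. *)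
Lemma sqnormD f g : cmeasurable f -> cmeasurable g ->
  (sqnorm mu (fun x => (f x + g x)%R) <= 2%:E * (sqnorm mu f + sqnorm mu g))%E.
Proof.
move=> mf mg.
have mF h : cmeasurable h ->
    measurable_fun setT (fun x => (cnorm (h x) ^+ 2)%:E).
  by move=> mh; apply/measurable_EFinP; exact: measurable_sqr_cnorm.
have F0 h x : (0 <= (cnorm (h x) ^+ 2)%:E :> \bar R)%E by rewrite lee_fin sqr_ge0.
rewrite /sqnorm -(ge0_integralD mu measurableT (fun x _ => F0 f x) (mF f mf)
  (fun x _ => F0 g x) (mF g mg)).
rewrite -(@ge0_integralZl _ _ _ mu _ measurableT
  (fun x => ((cnorm (f x) ^+ 2)%:E + (cnorm (g x) ^+ 2)%:E)%E)); last first.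
- by rewrite lee_fin.
- by move=> x _; rewrite adde_ge0.
- by apply: emeasurable_funD; exact: mF.
apply: ge0_le_integral => //.
- by move=> x _; exact: F0 (fun x => f x + g x) x.
- exact: mF _ (cmeasurableD mf mg).
- by apply: emeasurable_funM => //; apply: emeasurable_funD; exact: mF.
- by move=> x _; rewrite lee_fin sqr_cnormD.
Qed.

Lemma L20 : L2 mu (fun=> 0).
Proof.
split; first exact: cmeasurable_cst.
by rewrite /sqnorm; under eq_integral do rewrite cnorm0 expr0n /=; rewrite integral0.
Qed.

Lemma L2D f g : L2 mu f -> L2 mu g -> L2 mu (fun x => f x + g x).
Proof.
move=> [mf ff] [mg fg]; split; first exact: cmeasurableD.
apply: le_lt_trans (sqnormD mf mg) _.
by rewrite lte_mul_pinfty// lte_add_pinfty.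
Qed.

Lemma L2Z (a : R[i]) f : L2 mu f -> L2 mu (fun x => a * f x).
Proof.
move=> [mf ff]; split; first exact: cmeasurableM (cmeasurable_cst _) mf.
by rewrite sqnormZ// lte_mul_pinfty// lee_fin sqr_ge0.
Qed.

Lemma L2B f g : L2 mu f -> L2 mu g -> L2 mu (fun x => f x - g x).
Proof.
move=> f2 /(L2Z (-1)) g2; have := L2D f2 g2.
by under eq_fun do rewrite mulN1r.
Qed.

Lemma L2_lin_sum {I : Type} (A : seq I) (c : I -> R[i]) (F : I -> T -> R[i]) :
  (forall k, L2 mu (F k)) -> L2 mu (fun x => \sum_(k <- A) c k * F k x).
Proof.
move=> F2; elim: A => [|k A IH].
  by under eq_fun do rewrite big_nil; exact: L20.
by under eq_fun do rewrite big_cons; apply: L2D => //; exact: L2Z.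
Qed.

Lemma innerDl f g h : L2 mu f -> L2 mu g -> L2 mu h ->
  inner mu (fun x => f x + g x) h = inner mu f h + inner mu g h.
Proof.
move=> f2 g2 h2; rewrite /inner.
under [X in cintegral _ X]eq_fun do rewrite mulrDl.
by apply: cintegralD; exact: cintegrable_mul.
Qed.

Lemma innerZl (a : R[i]) f g : L2 mu f -> L2 mu g ->
  inner mu (fun x => a * f x) g = a * inner mu f g.
Proof.
move=> f2 g2; rewrite /inner.
under [X in cintegral _ X]eq_fun do rewrite -mulrA.
by apply: cintegralZ; exact: cintegrable_mul.
Qed.

Lemma inner_conj f g : L2 mu f -> L2 mu g ->
  inner mu g f = (inner mu f g)^*%C.
Proof.
move=> f2 g2; rewrite /inner -cintegral_conj; last exact: cintegrable_mul.
by congr cintegral; apply/funext => x; apply: complex_eq; rewrite !cE; ring.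
Qed.

Lemma innerDr f g h : L2 mu f -> L2 mu g -> L2 mu h ->
  inner mu h (fun x => f x + g x) = inner mu h f + inner mu h g.
Proof.
move=> f2 g2 h2; rewrite (inner_conj (L2D f2 g2) h2) innerDl//.
by rewrite (inner_conj f2 h2) (inner_conj g2 h2) rmorphD.
Qed.

Lemma innerZr (a : R[i]) f g : L2 mu f -> L2 mu g ->
  inner mu g (fun x => a * f x) = a^*%C * inner mu g f.
Proof.
move=> f2 g2; rewrite (inner_conj (L2Z a f2) g2) innerZl//.
by rewrite (inner_conj f2 g2) rmorphM.
Qed.

Lemma inner0l g : inner mu (fun=> 0) g = 0.
Proof.
rewrite /inner /cintegral; apply: complex_eq => /=;
  by under eq_Rintegral do rewrite mul0r; rewrite /Rintegral integral0.
Qed.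

Lemma inner_suml {I : Type} (A : seq I) (c : I -> R[i]) (F : I -> T -> R[i]) g :
  (forall k, L2 mu (F k)) -> L2 mu g ->
  inner mu (fun x => \sum_(k <- A) c k * F k x) g =
  \sum_(k <- A) c k * inner mu (F k) g.
Proof.
move=> F2 g2; elim: A => [|k A IH].
  by under [X in inner _ X]eq_fun do rewrite big_nil; rewrite big_nil inner0l.
under [X in inner _ X]eq_fun do rewrite big_cons.
rewrite big_cons innerDl ?innerZl ?IH//; first exact: L2Z.
exact: L2_lin_sum.
Qed.

Lemma inner_sumr {I : Type} (A : seq I) (c : I -> R[i]) (F : I -> T -> R[i]) g :
  (forall k, L2 mu (F k)) -> L2 mu g ->
  inner mu g (fun x => \sum_(k <- A) c k * F k x) =
  \sum_(k <- A) (c k)^*%C * inner mu g (F k).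
Proof.
move=> F2 g2; rewrite (inner_conj (L2_lin_sum A c F2) g2) inner_suml//.
rewrite rmorph_sum /=; apply: eq_bigr => k _.
by rewrite (inner_conj (F2 k) g2) rmorphM.
Qed.

(** The bridge between the extended-real [sqnorm] and real arithmetic: finiteness of the norm is
    what lets [fineK] remove the [fine] hidden in the real integral. *)
Lemma inner_self f : L2 mu f -> ((complex.Re (inner mu f f))%:E = sqnorm mu f)%E.
Proof.
move=> f2; rewrite /inner /= /Rintegral fineK.
  by apply: eq_integral => x _; rewrite mulc_conj.
under eq_integral do rewrite mulc_conj.
exact: integrable_fin_num (L2_integrable f2).
Qed.

Lemma sqnorm_fin_num f : L2 mu f -> sqnorm mu f \is a fin_num.
Proof. by move=> /inner_self <-. Qed.

(** Cauchy-Schwarz for the real part: the real quadratic polynomial [t] to [|f + t g|^2] is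
    nonnegative. *)
Lemma sqr_Re_inner_le f g : L2 mu f -> L2 mu g ->
  complex.Re (inner mu f g) ^+ 2 <=
  complex.Re (inner mu f f) * complex.Re (inner mu g g).
Proof.
move=> f2 g2.
have quad (t : R) : 0 <= complex.Re (inner mu f f)
    + 2 * t * complex.Re (inner mu f g) + t ^+ 2 * complex.Re (inner mu g g).
  have tg2 := L2Z t%:C%C g2; have h2 := L2D f2 tg2.
  have : 0 <= complex.Re (inner mu (fun x => f x + t%:C%C * g x)
                                   (fun x => f x + t%:C%C * g x)).
    by rewrite -lee_fin inner_self// sqnorm_ge0.
  rewrite innerDl// !innerDr// !innerZl// !innerZr//.
  rewrite (inner_conj f2 g2) !cE /=.
  congr (_ <= _); ring.
have [g0|g0] := eqVneq (complex.Re (inner mu g g)) 0.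
  have [->|fg0] := eqVneq (complex.Re (inner mu f g)) 0.
    by rewrite expr0n g0 mulr0.
  (* When [g] has norm 0 the polynomial is affine with nonzero slope; this [t] gives it the value
     -1, a contradiction. *)
  have := quad (- (complex.Re (inner mu f f) + 1) /
                (2 * complex.Re (inner mu f g))).
  rewrite g0 mulr0 addr0.
  set a := complex.Re (inner mu f f); set b := complex.Re (inner mu f g) in fg0 *.
  have -> : a + 2 * (- (a + 1) / (2 * b)) * b = -1 by field.
  lra.
(* The minimiser of the quadratic polynomial. *)
have := quad (- complex.Re (inner mu f g) / complex.Re (inner mu g g)).
have : 0 <= complex.Re (inner mu g g) by rewrite -lee_fin inner_self// sqnorm_ge0.
rewrite le_eqVlt eq_sym (negbTE g0) /=.
set a := complex.Re (inner mu f f); set b := complex.Re (inner mu f g).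
set c := complex.Re (inner mu g g) => c0.
have -> : a + 2 * (- b / c) * b + (- b / c) ^+ 2 * c = (a * c - b ^+ 2) / c.
  by field; rewrite gt_eqF.
by rewrite pmulr_lge0 ?invr_gt0// subr_ge0.
Qed.

(** The orthogonal complement of [g] is closed: [<f, g> = <f - h, g>], and Cauchy-Schwarz makes this
    arbitrarily small. *)
Lemma inner_approx0 f g : L2 mu f -> L2 mu g ->
  (forall e : R, 0 < e -> exists h, [/\ L2 mu h, inner mu h g = 0 &
     (sqnorm mu (fun x => (f x - h x)%R) < e%:E)%E]) ->
  inner mu f g = 0.
Proof.
move=> f2 g2 fap.
(* Cauchy-Schwarz controls real parts only; the unit scalars 1 and -i recover the real and the
   imaginary part of the inner product. *)
suff key (a : R[i]) : cnorm a = 1 -> complex.Re (a * inner mu f g) = 0.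
  apply: complex_eq => /=.
    have := key 1; rewrite mul1r; apply.
    by rewrite cnormE /= expr1n expr0n addr0 sqrtr1.
  have i1 : cnorm (0 +i* (-1) : R[i])%C = 1.
    by rewrite cnormE /= sqrrN expr1n expr0n add0r sqrtr1.
  by have := key _ i1; rewrite ReM mul0r mulN1r opprK add0r.
move=> a1; apply/eqP; rewrite -sqrf_eq0 eq_le sqr_ge0 andbT.
apply/ler_addgt0Pr => e e0; rewrite add0r.
set c := complex.Re (inner mu g g).
have c0 : 0 <= c by rewrite -lee_fin inner_self// sqnorm_ge0.
(* The squared inner product will be at most [e / (c + 1) * c], hence at most [e]; the added 1 keeps
   the denominator positive when [c = 0]. *)
have [h [h2 hg fh]] := fap (e / (c + 1)) (divr_gt0 e0 (ltr_wpDl c0 ltr01)).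
have fh2 := L2B f2 h2.
have : inner mu f g = inner mu (fun x => f x - h x) g + inner mu h g.
  by rewrite -innerDl//; congr inner; apply/funext => x; rewrite subrK.
rewrite hg addr0 => ->; rewrite -innerZl//.
apply: le_trans (sqr_Re_inner_le (L2Z a fh2) g2) _.
move: fh; rewrite -inner_self// lte_fin => fh.
have -> : complex.Re (inner mu (fun x => a * (f x - h x))
    (fun x => a * (f x - h x))) =
    complex.Re (inner mu (fun x => f x - h x) (fun x => f x - h x)).
  apply: EFin_inj; rewrite !inner_self//; last exact: L2Z.
  by rewrite sqnormZ ?a1 ?expr1n ?mul1e//; case: fh2.
apply: le_trans (ler_wpM2r c0 (ltW fh)) _.
by rewrite -/c mulrAC ler_pdivrMr ?ltr_wpDl// ler_wpM2l ?lerDl// ltW.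
Qed.

End L2space.

(** * Left invariance of integrals against Haar measure *)

Section LeftInvariance.
Context {R : realType} {G : topGroupType} (mu : {measure set (borel G) -> \bar R}).
Hypothesis hmu : left_haar mu.

Lemma lmul_continuous (g : G) : continuous (fun x : G => (g * x)%g).
Proof.
move=> x; apply: (@continuous_comp _ _ _ (fun y : G => (g, y))
  (fun z : G * G => (z.1 * z.2)%g)); last exact: mulg_continuous.
by apply: cvg_pair => /=; [exact: cvg_cst|exact: cvg_id].
Qed.

Lemma continuous_borel (X Y : ptopologicalType) (f : X -> Y) :
  continuous f -> measurable_fun setT (f : borel X -> borel Y).
Proof.
move=> /continuousP cf.
apply: (@measurability _ _ (borel X) (borel Y) setT f (@open Y)) => //.
move=> _ [B oB <-]; rewrite setTI; apply: sub_gen_smallest; exact: cf.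
Qed.

Lemma measurable_lmul (g : G) :
  measurable_fun setT ((fun x => (g * x)%g) : borel G -> borel G).
Proof. by apply: continuous_borel; exact: lmul_continuous. Qed.

(** The image of [mu] under left multiplication by [g] is [mu] again, because the preimage of [A] is
    [g^-1 A], which has the measure of [A]. *)
Lemma ge0_integral_lmul (g : G) (f : borel G -> \bar R) :
  measurable_fun setT f -> (forall x, 0 <= f x)%E ->
  (\int[mu]_x f (g * x)%g = \int[mu]_x f x)%E.
Proof.
move=> mf f0; have mg := measurable_lmul g.
rewrite -[LHS](ge0_integral_pushforward mg mu (D := setT) measurableT mf)//.
apply: eq_measure_integral => A mA _; rewrite /pushforward /=.
have [_ _ /(_ (g^-1)%g A mA) <-] := hmu; congr (mu _).
apply/seteqP; split => [x Ax|_ [x Ax <-]]; last by rewrite /preimage/= mulVKg.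
by exists (g * x)%g => //; rewrite mulKg.
Qed.

Lemma integral_lmul (g : G) (f : borel G -> \bar R) : measurable_fun setT f ->
  (\int[mu]_x f (g * x)%g = \int[mu]_x f x)%E.
Proof.
move=> mf; rewrite integralE [RHS]integralE; congr (_ - _)%E.
  rewrite -(ge0_integral_lmul g (measurable_funepos mf) (funepos_ge0 f)).
  by apply: eq_integral => x _; rewrite !funeposE.
rewrite -(ge0_integral_lmul g (measurable_funeneg mf) (funeneg_ge0 f)).
by apply: eq_integral => x _; rewrite !funenegE.
Qed.

End LeftInvariance.

(** * Systems of translates and their closed spans *)

Section Translates.
Context {R : realType} {G : topGroupType} (Gam : groupClosed G).
Context (mu : {measure set (borel G) -> \bar R}).
Hypothesis hmu : left_haar mu.
Implicit Types (f g phi psi : G -> R[i]) (a b : subgrp Gam).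
Local Notation E := (translates Gam).

Lemma translatesM f a b : E (E f b) a = E f (a * b)%g.
Proof. by apply/funext => x; rewrite /translates valM invgM mulgA. Qed.

Lemma translates1 f : E f 1%g = f.
Proof. by apply/funext => x; rewrite /translates val1 invg1 mul1g. Qed.

Lemma cmeasurable_translates f a :
  cmeasurable (f : borel G -> R[i]) -> cmeasurable (E f a : borel G -> R[i]).
Proof.
move=> [rf imf]; have mg := measurable_lmul ((val a)^-1)%g.
by split; [exact: (measurableT_comp rf mg)|exact: (measurableT_comp imf mg)].
Qed.

Lemma sqnorm_translates f a : cmeasurable (f : borel G -> R[i]) ->
  sqnorm mu (E f a) = sqnorm mu f.
Proof.
move=> mf; rewrite /sqnorm /translates.
rewrite (integral_lmul hmu _ (f := fun x => (cnorm (f x) ^+ 2)%:E))//.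
by apply/measurable_EFinP; exact: measurable_sqr_cnorm.
Qed.

Lemma L2_translates f a : L2 mu f -> L2 mu (E f a).
Proof.
move=> [mf foo]; split; first exact: cmeasurable_translates.
by rewrite sqnorm_translates.
Qed.

Lemma L1_translates f a : L1 mu f -> L1 mu (E f a).
Proof.
move=> [mf foo]; split; first exact: cmeasurable_translates.
rewrite /translates.
rewrite (integral_lmul hmu _ (f := fun x => (cnorm (f x))%:E))//.
by apply/measurable_EFinP; exact: measurable_cnorm.
Qed.

Lemma inner_translates f g a : L2 mu f -> L2 mu g ->
  inner mu (E f a) (E g a) = inner mu f g.
Proof.
move=> [mf _] [mg _]; have [mr mi] := cmeasurableM mf (cmeasurable_conj mg).
rewrite /inner /cintegral /Rintegral /translates.
rewrite (integral_lmul hmu _ (f := fun x => (complex.Re (f x * (g x)^*%C))%:E)).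
  rewrite (integral_lmul hmu _ (f := fun x => (complex.Im (f x * (g x)^*%C))%:E))//.
  by apply/measurable_EFinP.
by apply/measurable_EFinP.
Qed.

(** Translating both arguments by [a^-1] shows that mixed Gram entries depend on [a^-1 * b]
    alone. *)
Lemma inner_translatesl f g a b : L2 mu f -> L2 mu g ->
  inner mu (E f a) (E g b) = inner mu f (E g (a^-1 * b)%g).
Proof.
move=> f2 g2; rewrite -(inner_translates (a^-1)%g) ?translatesM//;
  try exact: L2_translates.
by rewrite mulVg translates1.
Qed.

Lemma closed_span_approx f phi (e : R) : closed_span mu (E phi) f -> 0 < e ->
  exists (A : {fset subgrp Gam}) (c : subgrp Gam -> R[i]),
    (sqnorm mu (fun x => (f x - \sum_(k <- A) c k * E phi k x)%R) < e%:E)%E.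
Proof.
move=> [_ sp] /sp[A [c lte]]; exists A, c; move: lte; congr (sqnorm mu _ < _)%E.
by apply/funext => x; rewrite fctE fct_sumE.
Qed.

Lemma mem_closed_span phi : L2 mu phi -> closed_span mu (E phi) phi.
Proof.
move=> phi2; split => // e e0; exists [fset 1%g]%fset, (fun=> 1).
have -> : phi - \sum_(k <- [fset 1%g]%fset) (fun x => 1 * E phi k x) = fun=> 0.
  apply/funext => x; rewrite big_seq_fset1 translates1.
  by rewrite !fctE mul1r subrr.
rewrite /sqnorm; under eq_integral do rewrite cnorm0 expr0n /=.
by rewrite integral0 lte_fin.
Qed.

(** Orthogonality of one generator to all translates of the other spreads to the closed spans, by
    two successive applications of [inner_approx0], one for each argument. *)
Lemma inner_closed_span0 phi psi : L2 mu phi -> L2 mu psi ->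
  (forall k, inner mu phi (E psi k) = 0) ->
  forall f g a, closed_span mu (E phi) f -> closed_span mu (E psi) g ->
  inner mu f (E g a) = 0.
Proof.
move=> phi2 psi2 ortho.
have step f : closed_span mu (E phi) f -> forall k, inner mu f (E psi k) = 0.
  move=> Sf k; have [f2 _] := Sf; apply: inner_approx0 => //.
    exact: L2_translates.
  move=> e e0; have [A [c fA]] := closed_span_approx Sf e0.
  exists (fun x => \sum_(k <- A) c k * E phi k x); split => //.
    by apply: L2_lin_sum => j; exact: L2_translates.
  rewrite inner_suml; [|by move=> j; exact: L2_translates|exact: L2_translates].
  by rewrite big1// => j _; rewrite inner_translatesl// ortho mulr0.
move=> f g a Sf Sg; have [f2 _] := Sf; have [g2 _] := Sg.
have fa2 := L2_translates (a^-1)%g f2.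
have ga2 := L2_translates a g2.
(* The translation is moved from [g] to [f], and conjugation then makes [g] the first argument,
   where it can be approximated by combinations of translates of [psi]. *)
rewrite -(inner_translates (a^-1)%g)// translatesM mulVg translates1.
rewrite (inner_conj g2 fa2).
suff -> : inner mu g (E f (a^-1)%g) = 0 by rewrite conjc0.
apply: inner_approx0 => // e e0; have [A [c gA]] := closed_span_approx Sg e0.
exists (fun x => \sum_(k <- A) c k * E psi k x); split => //.
  by apply: L2_lin_sum => j; exact: L2_translates.
rewrite inner_suml//; last by move=> j; exact: L2_translates.
rewrite big1// => j _; have j2 := L2_translates j psi2.
by rewrite (inner_conj fa2 j2) inner_translatesl// step// conjc0 mulr0.
Qed.

(** After the two summation indices are exchanged on one side, the coefficients agree and the Gram
    entries are [<phi, L_(j i^-1) phi>] and [<phi, L_(i^-1 j) phi>], equal by commutativity. *)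
Lemma sqnorm_inverse_sum phi (A : seq (subgrp Gam)) (c : subgrp Gam -> R[i]) :
  (forall a b, commute a b) -> L2 mu phi ->
  sqnorm mu (fun x => \sum_(k <- A) (c k)^*%C * E phi (k^-1)%g x) =
  sqnorm mu (fun x => \sum_(k <- A) c k * E phi k x).
Proof.
move=> comm phi2; have E2 k : L2 mu (E phi k) by exact: L2_translates.
have EV2 k : L2 mu (E phi (k^-1)%g) by exact: L2_translates.
rewrite -!inner_self; [|exact: L2_lin_sum..]; congr (complex.Re _)%:E.
rewrite !inner_suml//; [|exact: L2_lin_sum..].
under eq_bigr do rewrite inner_sumr// big_distrr /=.
under [RHS]eq_bigr do rewrite inner_sumr// big_distrr /=.
rewrite exchange_big /=; apply: eq_bigr => i _; apply: eq_bigr => j _.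
rewrite conjcK mulrCA; congr (_ * (_ * _)).
by rewrite !inner_translatesl// invgK comm.
Qed.

(** In quantitative form: with [h] a partial sum over a finite set containing [k], and [h'] its
    inverted and conjugated version, [|c_k|^2 <= Re <h', psi>], so [|c_k|^4 <= |h'|^2 |psi|^2 =
    |h|^2 |psi|^2], which is arbitrarily small. *)
Lemma synthesis0_coef0 phi psi : (forall a b, commute a b) ->
  L2 mu phi -> L2 mu psi ->
  sums_to (sqnorm mu) (fun k x => inner mu phi (E psi k) * E phi k x) 0 ->
  forall k, inner mu phi (E psi k) = 0.
Proof.
move=> comm phi2 psi2 sum0 k; set c := fun k => inner mu phi (E psi k).
have E2 j : L2 mu (E phi j) by exact: L2_translates.
have EV2 j : L2 mu (E phi (j^-1)%g) by exact: L2_translates.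
set B := complex.Re (inner mu psi psi).
have B0 : 0 <= B by rewrite -lee_fin inner_self// sqnorm_ge0.
(* A fourth power, because the squared form of Cauchy-Schwarz is applied to a quantity that
   dominates [|c_k|^2]. *)
suff ck : (cnorm (c k) ^+ 2) ^+ 2 <= 0.
  apply: cnorm0_eq0; apply/eqP; rewrite -sqrf_eq0 -sqrf_eq0 eq_le ck.
  by rewrite sqr_ge0.
apply/ler_addgt0Pr => e e0; rewrite add0r.
(* Adjoining [k] to the threshold set guarantees that [|c_k|^2] is one of the nonnegative terms of
   [<h', psi>]. *)
have [A0 /(_ (k |` A0)%fset (fsubsetU1 _ _))] :=
  sum0 _ (divr_gt0 e0 (ltr_wpDl B0 ltr01)).
set A := (k |` A0)%fset.
set h := fun x => \sum_(j <- A) c j * E phi j x.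
have h2 : L2 mu h by exact: L2_lin_sum.
have -> : (\sum_(j <- A) (fun x => inner mu phi (E psi j) * E phi j x) - 0)%R = h.
  by rewrite subr0; apply/funext => x; rewrite fct_sumE.
set h' := fun x => \sum_(j <- A) (c j)^*%C * E phi (j^-1)%g x.
have h'2 : L2 mu h' by apply: (L2_lin_sum A (fun j => (c j)^*%C) EV2).
rewrite -(sqnorm_inverse_sum _ _ comm)// -/h' -inner_self// lte_fin => lte.
(* Inversion is chosen for this identity: [<L_(j^-1) phi, psi> = <phi, L_j psi> = c_j], which meets
   its own conjugate. *)
have ip : complex.Re (inner mu h' psi) = \sum_(j <- A) cnorm (c j) ^+ 2.
  rewrite (inner_suml A (fun j => (c j)^*%C) EV2 psi2).
  rewrite (eq_bigr (fun j => ((cnorm (c j) ^+ 2)%:C)%C)) -?rmorph_sum// => j _.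
  rewrite -mulc_conj mulrC; congr (_ * _).
  by rewrite -[X in inner mu _ X]translates1 inner_translatesl// invgK mulg1.
have ckA : cnorm (c k) ^+ 2 <= complex.Re (inner mu h' psi).
  rewrite ip (big_fsetD1 k) ?fset1U1//= lerDl; apply: sumr_ge0 => j _.
  exact: sqr_ge0.
apply: le_trans (_ : complex.Re (inner mu h' psi) ^+ 2 <= _).
  by rewrite ler_sqr ?nnegrE ?sqr_ge0// (le_trans _ ckA)// sqr_ge0.
apply: le_trans (sqr_Re_inner_le h'2 psi2) _.
apply: le_trans (ler_wpM2r B0 (ltW lte)) _.
by rewrite mulrAC ler_pdivrMr ?ltr_wpDl// ler_wpM2l ?lerDl// ltW.
Qed.

End Translates.

(** Every term of the series is 0, so all finite partial sums vanish and the empty set serves as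
    threshold. *)
Lemma annihilates_ortho {R : realType} {d : measure_display}
    {T : measurableType d} (mu : {measure set T -> \bar R}) {I : choiceType}
    (K : set (T -> R[i])) (F H : I -> T -> R[i]) :
  (forall f k, K f -> inner mu f (H k) = 0) -> annihilates mu K F H.
Proof.
move=> ortho f Kf e e0; exists fset0 => A _.
rewrite /sqnorm subr0; under eq_integral => x _.
  rewrite fct_sumE big1 ?cnorm0 ?expr0n /=; last first.
    by move=> k _; rewrite ortho// mul0r.
  over.
by rewrite integral0 lte_fin.
Qed.

(** * Null sets, polarization, and density of L^1 in L^2 *)

Section Nullity.
Context {R : realType} {d : measure_display} {T : measurableType d}.
Variable mu : {measure set T -> \bar R}.
Implicit Types f g : T -> R[i].

Lemma sqnorm_eq0 f : cmeasurable f -> sqnorm mu f = 0%E ->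
  {ae mu, forall x, f x = 0}.
Proof.
move=> mf f0.
have mf2 : measurable_fun setT (fun x => (cnorm (f x) ^+ 2)%:E).
  by apply/measurable_EFinP; exact: measurable_sqr_cnorm.
have /(ae_eq_integral_abs mu measurableT mf2) : (\int[mu]_x
    `|(cnorm (f x) ^+ 2)%:E| = 0)%E.
  by rewrite -[RHS]f0; apply: eq_integral => x _; rewrite gee0_abs// lee_fin sqr_ge0.
apply: filterS => x /(_ I) [/eqP]; rewrite sqrf_eq0 => /eqP.
exact: cnorm0_eq0.
Qed.

Lemma sqnorm_ae f g : cmeasurable f -> cmeasurable g ->
  {ae mu, forall x, f x = g x} -> sqnorm mu f = sqnorm mu g.
Proof.
move=> mf mg fg; apply: ae_eq_integral => //.
- by apply/measurable_EFinP; exact: measurable_sqr_cnorm.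
- by apply/measurable_EFinP; exact: measurable_sqr_cnorm.
- by apply: filterS fg => x -> _.
Qed.

Lemma cintegral_ae0 f : cmeasurable f -> {ae mu, forall x, f x = 0} ->
  cintegral mu f = 0.
Proof.
move=> [rf imf] f0.
have z (h : R[i] -> R) : h 0 = 0 -> measurable_fun setT (h \o f) ->
    (\int[mu]_x h (f x))%R = 0.
  move=> h0 mh; rewrite /Rintegral (ae_eq_integral (fun=> 0%E)) ?integral0//.
    exact/measurable_EFinP.
  by apply: filterS f0 => x -> _; rewrite h0.
by apply: complex_eq; rewrite /= z.
Qed.

Lemma inner_ae f g h : L2 mu f -> L2 mu g -> L2 mu h ->
  {ae mu, forall x, f x = g x} -> inner mu h f = inner mu h g.
Proof.
move=> f2 g2 h2 fg; have d2 := L2B f2 g2.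
have -> : f = (fun x => (f x - g x) + g x) by apply/funext => x; rewrite subrK.
rewrite innerDr// -[RHS]add0r; congr (_ + _); apply: cintegral_ae0.
  by apply: cmeasurableM; [case: h2|apply: cmeasurable_conj; case: d2].
by apply: filterS fg => x ->; rewrite subrr conjc0 mulr0.
Qed.

(** The polarization identity: letting [a] vary, the cross term recovers the inner product from
    norms. It turns the isometry of [Z] into preservation of inner products. *)
Lemma sqnorm_lin (a : R[i]) f g : L2 mu f -> L2 mu g ->
  complex.Re (inner mu (fun x => a * f x + g x) (fun x => a * f x + g x)) =
  cnorm a ^+ 2 * complex.Re (inner mu f f) + 2 * complex.Re (a * inner mu f g)
    + complex.Re (inner mu g g).
Proof.
move=> f2 g2; have af2 := L2Z a f2; have s2 := L2D af2 g2.
rewrite innerDl// !innerDr// !innerZl// !innerZr// (inner_conj f2 g2).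
by rewrite sqr_cnorm !cE; ring.
Qed.

(** Truncate [f] to the set where [|f| >= 1/(n+1)]. There [|f| <= (n+1) |f|^2], so the truncation is
    integrable; dominated convergence, with bound [|f|^2], sends the error to 0. *)
Lemma L1_dense f (e : R) : L2 mu f -> 0 < e ->
  exists g, [/\ L1 mu g, L2 mu g & (sqnorm mu (fun x => (f x - g x)%R) < e%:E)%E].
Proof.
move=> f2 e0; have [mf ffin] := f2; have mcf := measurable_cnorm mf.
pose S n := (fun x => cnorm (f x)) @^-1` `[n.+1%:R^-1, +oo[%classic.
have inS n x : (x \in S n) = (n.+1%:R^-1 <= cnorm (f x)).
  apply/idP/idP => [/set_mem|le1]; last apply: mem_set;
    by rewrite /S /preimage /= in_itv /= andbT.
have mS n : measurable (S n) by rewrite -[S n]setTI; exact: mcf.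
pose g n x := (\1_(S n) x)%:C%C * f x.
have gE n x : g n x = if x \in S n then f x else 0.
  by rewrite /g indicE; case: ifPn => _; rewrite ?mul1r ?mul0r.
have mg n : cmeasurable (g n).
  apply: cmeasurableM => //; split => /=; last exact: measurable_cst.
  exact: measurable_indic.
have gle n x : cnorm (g n x) <= n.+1%:R * cnorm (f x) ^+ 2.
  rewrite gE inS; case: ifPn => [le1|_]; last first.
    by rewrite cnorm0 mulr_ge0// sqr_ge0.
  rewrite expr2 mulrA ler_peMl ?cnorm_ge0//.
  by rewrite -(ler_pdivrMl _ _ (ltr0Sn _ _)) mulr1.
have g1 n : L1 mu (g n).
  split => //; apply: le_lt_trans (_ : n.+1%:R%:E * sqnorm mu f < +oo)%E; last first.
    by rewrite lte_mul_pinfty.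
  rewrite /sqnorm -ge0_integralZl//; last 2 first.
  - by apply/measurable_EFinP; exact: measurable_sqr_cnorm.
  - by move=> x _; rewrite lee_fin sqr_ge0.
  apply: ge0_le_integral => //.
  - by move=> x _; rewrite lee_fin cnorm_ge0.
  - by apply/measurable_EFinP; exact: measurable_cnorm.
  - apply/measurable_EFinP; apply: measurable_funM => //.
    exact: measurable_sqr_cnorm.
  - by move=> x _; rewrite lee_fin gle.
have fgle n x : cnorm (f x - g n x) ^+ 2 <= cnorm (f x) ^+ 2.
  by rewrite gE; case: ifPn => _; rewrite ?subr0// subrr cnorm0 expr0n sqr_ge0.
have mfg n : cmeasurable (fun x => f x - g n x).
  have := cmeasurableD mf (cmeasurableM (cmeasurable_cst (-1)) (mg n)).
  by under eq_fun do rewrite mulN1r.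
have mfg2 n : measurable_fun setT (fun x => (cnorm (f x - g n x) ^+ 2)%:E).
  by apply/measurable_EFinP; exact: measurable_sqr_cnorm.
have fg2 n : L2 mu (fun x => f x - g n x).
  split => //; apply: le_lt_trans ffin; apply: ge0_le_integral => //.
  - by move=> x _; rewrite lee_fin sqr_ge0.
  - by apply/measurable_EFinP; exact: measurable_sqr_cnorm.
  - by move=> x _; rewrite lee_fin.
have g2 n : L2 mu (g n).
  have := L2B f2 (fg2 n); congr (L2 mu _).
  by apply/funext => x; rewrite opprB addrC subrK.
have : (fun n => sqnorm mu (fun x => f x - g n x)) @ \oo --> (\int[mu]_x (cst 0 x))%E.
  apply: (@dominated_cvg _ _ _ mu setT measurableT
      (fun n x => (cnorm (f x - g n x) ^+ 2)%:E) (cst 0%E)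
      (fun x => (cnorm (f x) ^+ 2)%:E)) => //.
  (* At each point the error is eventually exactly 0: either [f x = 0], or [1/(n+1)] drops below
     [|f x|]. *)
  - move=> x _; apply: cvg_near_cst => /=.
    have [fx0|fx0] := eqVneq (cnorm (f x)) 0.
      apply: nearW => n; have := fgle n x; rewrite fx0 expr0n /= => le0.
      by congr EFin; apply/le_anti; rewrite le0 sqr_ge0.
    have fxgt0 : 0 < cnorm (f x) by rewrite lt0r fx0 cnorm_ge0.
    near=> n; rewrite gE inS ifT ?subrr ?cnorm0 ?expr0n//.
    by apply: ltW; near: n; exact: near_infty_natSinv_lt (PosNum fxgt0).
  - exact: L2_integrable.
  - by move=> n x _ /=; rewrite lee_fin ger0_norm ?sqr_ge0.
rewrite integral0 => /fine_cvgP[_ /cvgrPdist_lt/(_ _ e0)[N _ /(_ N (leqnn N))]] /=.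
rewrite sub0r normrN => lte; exists (g N); split => //.
rewrite -(fineK (sqnorm_fin_num (fg2 N))) lte_fin.
exact: le_lt_trans (ler_norm _) lte.
Unshelve. all: by end_near.
Qed.

End Nullity.

(** * Measurability of the evaluation of characters *)

Lemma near_dist_lt (K : numFieldType) (z e : K) :
  0 < e -> \forall w \near z, `|z - w| < e.
Proof.
by move=> e0; have /cvgrPdist_lt := @cvg_id _ (nbhs z); exact.
Qed.

Section Characters.
Context {R : realType} {A : groupType}.
Local Notation C := (R[i] : numFieldType).

Lemma Re_Im_continuous :
  continuous (fun z : C => complex.Re z) /\
  continuous (fun z : C => complex.Im z).
Proof.
have bnd (z : R[i]) : `|complex.Re z| <= cnorm z /\ `|complex.Im z| <= cnorm z.
  rewrite cnormE -!sqrtr_sqr; split; apply: ler_wsqrtr.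
    by rewrite lerDl sqr_ge0.
  by rewrite lerDr sqr_ge0.
have near_cnorm (z : C) (e : R) : 0 < e -> \forall w \near z, cnorm (z - w) < e.
  move=> e0; have ce0 : 0 < (e%:C%C : C) by rewrite ltcR.
  by near=> w; rewrite -ltcR cnormC; near: w; exact: near_dist_lt.
split=> z; apply/(@cvgrPdist_lt _ _ _ _ (nbhs_filter z)) => e e0; near=> w.
- have [+ _] := bnd (z - w); rewrite raddfB /= => /le_lt_trans; apply.
  by near: w; exact: near_cnorm.
- have [_ +] := bnd (z - w); rewrite raddfB /= => /le_lt_trans; apply.
  by near: w; exact: near_cnorm.
Unshelve. all: by end_near.
Qed.

(** Kept apart from [continuous_borel] because the sigma-algebra of [R] is presented here by open
    intervals as generators. *)
Lemma continuous_borel_real (X : ptopologicalType) (f : X -> R) :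
  continuous f -> measurable_fun setT (f : borel X -> R).
Proof.
move=> /continuousP cf; apply: (measurability _ (RGenOpens.measurableE R)).
move=> _ [_ [a [b ->] <-]]; rewrite setTI; apply: sub_gen_smallest.
exact/cf/interval_open.
Qed.

Lemma cmeasurable_ev (a : A) :
  cmeasurable ((fun al => ev al a) : borel (dual R A) -> R[i]).
Proof.
have [cr ci] := Re_Im_continuous.
split; apply: (@continuous_borel_real (dual R A)) => x;
  by apply: continuous_comp; [exact: ev_continuous|exact: cr || exact: ci].
Qed.

End Characters.

(** * Uniqueness and reindexing of unconditional sums *)

Section SumsTo.
Context {R : realType}.
Local Notation N := (fun z : R[i] => (cnorm z)%:E).

Lemma sums_to_unique (I : choiceType) (F : I -> R[i]) s t :
  sums_to N F s -> sums_to N F t -> s = t.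
Proof.
move=> Fs Ft; apply/eqP; rewrite -subr_eq0; apply/eqP/cnorm0_eq0/eqP.
rewrite eq_le cnorm_ge0 andbT; apply/ler_addgt0Pr => e e0; rewrite add0r.
have e2 : 0 < e / 2 by rewrite divr_gt0.
have [A /(_ (A `|` _)%fset (fsubsetUl _ _)) sA] := Fs _ e2.
have [B /(_ (A `|` B)%fset (fsubsetUr _ _)) sB] := Ft _ e2.
have {}sA := sA B; move: sA sB; rewrite !lte_fin.
set S := \sum_(k <- _) _ => sA sB.
have -> : s - t = (S - t) + - (S - s) by ring.
apply: le_trans (ler_cnormD _ _) _; rewrite cnormN.
by rewrite (splitr e) lerD// ltW.
Qed.

(* The substitution k = a j in the series. *)
Lemma sums_to_lmul (I : groupType) (a : I) (F H : I -> R[i]) (c s : R[i]) :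
  cnorm c = 1 -> (forall j, H (a * j)%g = c * F j) ->
  sums_to N F s -> sums_to N H (c * s).
Proof.
move=> c1 HF Fs e e0; have [A0 FA0] := Fs _ e0.
exists [fset (a * j)%g | j in A0]%fset => A A0A.
pose B := [fset (a^-1 * k)%g | k in A]%fset.
have : (A0 `<=` B)%fset.
  apply/fsubsetP => j jA0; apply/imfsetP; exists (a * j)%g; rewrite ?mulKg//=.
  by apply: (fsubsetP A0A); apply/imfsetP; exists j.
move=> /FA0; congr (_ < _)%E; congr EFin.
rewrite big_imfset /=; last by move=> ? ? _ _; exact: mulgI.
rewrite -[LHS]mul1r -c1 -cnormM mulrBr mulr_sumr; congr (cnorm (_ - _)).
by apply: eq_bigr => k _; rewrite -HF mulVKg.
Qed.

End SumsTo.

(** * The Zak transform: inner products and translations *)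

Section Zak.
Context {R : realType} {G : topGroupType} {Gam : groupClosed G}.
Context (mu : {measure set (borel G) -> \bar R})
  (nu : {sigma_finite_measure set (borel (coset_space Gam)) -> \bar R})
  (P : probability (borel (dual R (subgrp Gam))) R)
  (Xi : coset_space Gam -> G)
  (Z : (G -> R[i]) ->
       borel (dual R (subgrp Gam)) * borel (coset_space Gam) -> R[i]).
Hypotheses (hmu : left_haar mu) (zakZ : zak_transform mu nu P Xi Z).
Implicit Types f g phi psi : G -> R[i].
Local Notation E := (translates Gam).
Local Notation PN := (P \x nu)%E.

Let Z2 f : L2 mu f -> L2 PN (Z f). Proof. by have [+ _ _ _ _] := zakZ; exact. Qed.

Lemma sqnorm_zakB f g : L2 mu f -> L2 mu g ->
  sqnorm PN (fun p => Z f p - Z g p) = sqnorm mu (fun x => f x - g x).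
Proof.
move=> f2 g2; have [_ lin iso _ _] := zakZ.
have fg2 := L2B f2 g2; have Zfg2 := L2B (Z2 f2) (Z2 g2).
rewrite -(iso _ fg2); apply: sqnorm_ae; [exact: Zfg2.1|exact: (Z2 fg2).1|].
have -> : (fun x => f x - g x) = (fun x => -1 * g x + f x).
  by apply/funext => x; rewrite mulN1r addrC.
by apply: filterS (lin (-1) g f g2 f2) => p ->; rewrite mulN1r addrC.
Qed.

(** Polarization: [sqnorm_lin] on both sides, with linearity and isometry of [Z], gives equal real
    parts after multiplication by any scalar [a]; then [a = 1] and [a = -i] suffice. *)
Lemma inner_zak f g : L2 mu f -> L2 mu g ->
  inner PN (Z f) (Z g) = inner mu f g.
Proof.
move=> f2 g2; have [_ lin iso _ _] := zakZ.
have isoR h : L2 mu h ->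
    complex.Re (inner PN (Z h) (Z h)) = complex.Re (inner mu h h).
  by move=> h2; apply: EFin_inj; rewrite !inner_self ?iso//; exact: Z2.
have key (a : R[i]) :
    complex.Re (a * inner PN (Z f) (Z g)) = complex.Re (a * inner mu f g).
  have s2 := L2D (L2Z a f2) g2; have Zs2 := L2D (L2Z a (Z2 f2)) (Z2 g2).
  have := sqnorm_lin a f2 g2; have := sqnorm_lin a (Z2 f2) (Z2 g2).
  have -> : complex.Re (inner PN (fun p => a * Z f p + Z g p)
      (fun p => a * Z f p + Z g p)) =
      complex.Re (inner mu (fun x => a * f x + g x) (fun x => a * f x + g x)).
    apply: EFin_inj; rewrite !inner_self// -(iso _ s2).
    apply: sqnorm_ae; [exact: Zs2.1|exact: (Z2 s2).1|].
    by apply: filterS (lin a f g f2 g2) => p ->.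
  by rewrite !isoR// => -> /eqP; rewrite -subr_eq0 => /eqP; lra.
apply: complex_eq; first by have := key 1; rewrite !mul1r.
have := key (0 +i* (-1))%C.
by rewrite !ReM !mul0r !mulN1r !opprK !add0r.
Qed.

(** On L^1 functions in L^2 this is the substitution [k = a j] in the defining series. The general
    case follows by density, both sides being isometric in [f]. *)
Lemma zak_translates f a : L2 mu f -> {ae PN, forall p,
  Z (E f a) p = ev p.1 (a^-1)%g * Z f p}.
Proof.
move=> f2; have [_ _ iso _ ser] := zakZ.
have mev : cmeasurable ((fun p => ev p.1 (a^-1)%g) :
    borel (dual R (subgrp Gam)) * borel (coset_space Gam) -> R[i]).
  have [mr mi] := @cmeasurable_ev R _ (a^-1)%g.
  by split; [exact: (measurableT_comp mr measurable_fst)|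
             exact: (measurableT_comp mi measurable_fst)].
have evZ2 (g : borel (dual R (subgrp Gam)) * borel (coset_space Gam) -> R[i]) :
    L2 PN g -> L2 PN (fun p => ev p.1 (a^-1)%g * g p) /\
    sqnorm PN (fun p => ev p.1 (a^-1)%g * g p) = sqnorm PN g.
  move=> [mg goo]; have eqn : sqnorm PN (fun p => ev p.1 (a^-1)%g * g p) = sqnorm PN g.
    apply: eq_integral => p _.
    by rewrite cnormM (cnorm_unit (ev_norm _ _)) mul1r.
  by split=> //; split; [exact: cmeasurableM|rewrite eqn].
have L1case g : L1 mu g -> L2 mu g -> {ae PN, forall p,
    Z (E g a) p = ev p.1 (a^-1)%g * Z g p}.
  move=> g1 g2; have Eg1 := L1_translates hmu a g1.
  have Eg2 := L2_translates hmu a g2.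
  have aeF : Filter (almost_everywhere PN) by exact: ae_filter_ringOfSetsType.
  apply: filterS2 (ser _ g1 g2) (ser _ Eg1 Eg2) => p sg sEg.
  apply: sums_to_unique sEg _; apply: (sums_to_lmul (a := a) _ _ sg).
    exact: cnorm_unit (ev_norm _ _).
  move=> j; rewrite /translates valM -mulgA mulKg invgM evM.
  by ring.
set D := fun p => Z (E f a) p - ev p.1 (a^-1)%g * Z f p.
have Ef2 := L2_translates hmu a f2.
have D2 : L2 PN D by apply: L2B; [exact: Z2|exact: (evZ2 _ (Z2 f2)).1].
suff D0 : sqnorm PN D = 0%E.
  apply: filterS (sqnorm_eq0 D2.1 D0) => p; rewrite /D => /eqP.
  by rewrite subr_eq0 => /eqP.
apply/eqP; rewrite eq_le sqnorm_ge0 andbT.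
apply/lee_addgt0Pr => e e0; rewrite add0e.
(* The tolerance is [e / 4]: [D] splits into [D1 + D3], each of squared norm [|f - g|^2], and
   [sqnormD] contributes another factor 2. *)
have [g [g1 g2 fg]] := L1_dense f2 (divr_gt0 e0 (ltr0Sn _ 3)).
have Eg2 := L2_translates hmu a g2.
set D1 := fun p => Z (E f a) p - Z (E g a) p.
set D3 := fun p => ev p.1 (a^-1)%g * (Z g p - Z f p).
have D12 : L2 PN D1 by apply: L2B; exact: Z2.
have [D32 D3E] := evZ2 _ (L2B (Z2 g2) (Z2 f2)).
have -> : sqnorm PN D = sqnorm PN (fun p => D1 p + D3 p).
  apply: sqnorm_ae; [exact: D2.1|exact: (L2D D12 D32).1|].
  apply: filterS (L1case g g1 g2) => p; rewrite /D /D1 /D3 => ->.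
  by rewrite mulrBr addrA subrK.
apply: le_trans (sqnormD _ D12.1 D32.1) _.
rewrite D3E !sqnorm_zakB//.
have -> : sqnorm mu (fun x => g x - f x) = sqnorm mu (fun x => f x - g x).
  by apply: eq_integral => x _; rewrite -opprB cnormN.
have -> : sqnorm mu (fun x => E f a x - E g a x) = sqnorm mu (fun x => f x - g x).
  exact: (sqnorm_translates hmu a (f := fun x => f x - g x) (L2B f2 g2).1).
rewrite -(fineK (sqnorm_fin_num (L2B f2 g2))) -EFinD -EFinM lee_fin.
by move: fg; rewrite -{1}(fineK (sqnorm_fin_num (L2B f2 g2))) lte_fin; lra.
Qed.

End Zak.

(** * The bracket and the fibres over the dual group *)

Section Bracket.
Context {R : realType} {G : topGroupType} {Gam : groupClosed G}.
Context (nu : {sigma_finite_measure set (borel (coset_space Gam)) -> \bar R})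
  (P : probability (borel (dual R (subgrp Gam))) R).
Local Notation DQ :=
  (borel (dual R (subgrp Gam)) * borel (coset_space Gam))%type.
Local Notation PN := (P \x nu)%E.
Implicit Types F H : DQ -> R[i].

Lemma cmeasurable_section F al : cmeasurable F ->
  cmeasurable ((fun q => F (al, q)) : borel (coset_space Gam) -> R[i]).
Proof.
move=> [rF iF].
by split; [exact: (measurable_fun_pair2 al rF)|exact: (measurable_fun_pair2 al iF)].
Qed.

Lemma bracket_self F al : cmeasurable F ->
  bracket nu F F al = (fine (sqnorm nu (fun q => F (al, q))))%:C%C.
Proof.
move=> mF; rewrite /bracket /cintegral; apply: complex_eq => /=.
  by rewrite /Rintegral; congr fine; apply: eq_integral => q _; rewrite mulc_conj.
by under eq_Rintegral do rewrite mulc_conj /=; rewrite /Rintegral integral0.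
Qed.

Lemma bracket_ae0l F H al : cmeasurable F -> cmeasurable H ->
  {ae nu, forall q, F (al, q) = 0} -> bracket nu F H al = 0.
Proof.
move=> mF mH F0; apply: cintegral_ae0.
  by apply: cmeasurableM; [|apply: cmeasurable_conj]; exact: cmeasurable_section.
by apply: filterS F0 => q ->; rewrite mul0r.
Qed.

Lemma bracket_ae0r F H al : cmeasurable F -> cmeasurable H ->
  {ae nu, forall q, H (al, q) = 0} -> bracket nu F H al = 0.
Proof.
move=> mF mH H0; apply: cintegral_ae0.
  by apply: cmeasurableM; [|apply: cmeasurable_conj]; exact: cmeasurable_section.
by apply: filterS H0 => q ->; rewrite conjc0 mulr0.
Qed.

(* The finiteness of the fibre norm matters here: on a fibre of infinite norm
   the real-valued integral in the bracket is 0 by convention. *)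
Lemma bracket_self_eq0 F : L2 PN F -> {ae P, forall al,
  bracket nu F F al = 0 -> {ae nu, forall q, F (al, q) = 0}}.
Proof.
move=> F2; have mF := F2.1.
have iF := integrable_fubini_F (L2_integrable F2).
apply: filterS (integrable_ae measurableT iF) => al /(_ I) fin br0.
apply: sqnorm_eq0; first exact: cmeasurable_section.
have := br0; rewrite bracket_self// => -[fine0].
by rewrite -[LHS](fineK fin) fine0.
Qed.

(** By Tonelli the fibre norms are nonnegative with integral 0, hence vanish almost everywhere. *)
Lemma bracket_self_ae0 F : L2 PN F -> sqnorm PN F = 0%E ->
  {ae P, forall al, bracket nu F F al = 0}.
Proof.
move=> F2 F0; have mF := F2.1.
have mF2 : measurable_fun setT (fun p => (cnorm (F p) ^+ 2)%:E).
  by apply/measurable_EFinP; exact: measurable_sqr_cnorm.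
have Fge0 p : (0 <= (cnorm (F p) ^+ 2)%:E)%E by rewrite lee_fin sqr_ge0.
have mFF := measurable_fun_fubini_tonelli_F (m2 := nu) _ mF2 Fge0.
have : (\int[P]_al `|sqnorm nu (fun q => F (al, q))| = 0)%E.
  rewrite -[RHS]F0 [RHS](fubini_tonelli1 _ mF2 Fge0).
  by apply: eq_integral => al _; rewrite gee0_abs// sqnorm_ge0.
move/(ae_eq_integral_abs P measurableT mFF); apply: filterS => al /(_ I) al0.
by rewrite bracket_self// (_ : sqnorm _ _ = 0%E).
Qed.

(** By Fubini the inner product is the integral over the dual of the conjugate of [chi] times the
    bracket. *)
Lemma inner_bracket0 F H (chi : borel (dual R (subgrp Gam)) -> R[i]) :
  L2 PN F -> L2 PN H -> cmeasurable chi -> (forall al, `|chi al| = 1) ->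
  {ae P, forall al, bracket nu F H al = 0} ->
  inner PN F (fun p => chi p.1 * H p) = 0.
Proof.
move=> F2 H2 mchi chi1 br0.
have cH2 : L2 PN (fun p => chi p.1 * H p).
  split; first apply: cmeasurableM H2.1.
    by split; [exact: (measurableT_comp mchi.1 measurable_fst)|
               exact: (measurableT_comp mchi.2 measurable_fst)].
  rewrite [X in (X < _)%E](_ : _ = sqnorm PN H); first exact: H2.2.
  by apply: eq_integral => p _; rewrite cnormM (cnorm_unit (chi1 _)) mul1r.
have [iRe iIm] := cintegrable_mul F2 H2.
have [jRe jIm] := cintegrable_mul F2 cH2.
have fibre : {ae P, forall al,
    cintegral nu (fun q => F (al, q) * (chi al * H (al, q))^*%C) = 0}.
  (* Almost every fibre product is integrable, which allows the constant [chi al] to be taken out of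
     the fibre integral. *)
  have := ae_integrable1 iIm; have := ae_integrable1 iRe; move: br0.
  apply: filterS3 => al br0 i1 i2.
  have -> : (fun q => F (al, q) * (chi al * H (al, q))^*%C) =
      (fun q => (chi al)^*%C * (F (al, q) * (H (al, q))^*%C)).
    by apply/funext => q; rewrite rmorphM mulrCA.
  by rewrite cintegralZ//; rewrite -[X in _ * X]/(bracket nu F H al) br0 mulr0.
apply: complex_eq; rewrite /= /Rintegral -integral12_prod_meas1//.
  rewrite (ae_eq_integral (fun=> 0%E)) ?integral0//.
    exact: measurable_fubini_F jRe.
  (* A vanishing [fine] could hide an infinite fibre integral; integrability of almost every fibre
     excludes this. *)
  have := ae_integrable1 jRe; move: fibre; apply: filterS2 => al [+ _] i1 _.
  rewrite /Rintegral /fubini_F /= => re0.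
  by rewrite -[LHS]fineK ?re0//; exact: integrable_fin_num i1.
rewrite (ae_eq_integral (fun=> 0%E)) ?integral0//.
  exact: measurable_fubini_F jIm.
have := ae_integrable1 jIm; move: fibre; apply: filterS2 => al [_ +] i1 _.
rewrite /Rintegral /fubini_F /= => im0.
by rewrite -[LHS]fineK ?im0//; exact: integrable_fin_num i1.
Qed.

End Bracket.

(** Carried through [Z], translation of [psi] by [k] becomes multiplication by [ev al (k^-1)], a
    function of modulus 1 on the dual, so [inner_bracket0] applies. *)
Lemma inner_translates_bracket0 (R : realType) (G : topGroupType)
    (Gam : groupClosed G) (mu : {measure set (borel G) -> \bar R})
    (nu : {sigma_finite_measure set (borel (coset_space Gam)) -> \bar R})
    (P : probability (borel (dual R (subgrp Gam))) R)
    (Xi : coset_space Gam -> G)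
    (Z : (G -> R[i]) ->
         borel (dual R (subgrp Gam)) * borel (coset_space Gam) -> R[i])
    (phi psi : G -> R[i]) (k : subgrp Gam) :
  left_haar mu -> zak_transform mu nu P Xi Z -> L2 mu phi -> L2 mu psi ->
  {ae P, forall al, bracket nu (Z phi) (Z psi) al = 0} ->
  inner mu phi (translates Gam psi k) = 0.
Proof.
move=> hmu zakZ phi2 psi2 br0; have Epsi2 := L2_translates hmu k psi2.
have [Z2 _ _ _ _] := zakZ.
have mev := @cmeasurable_ev R _ (k^-1)%g.
have evZ2 : L2 (P \x nu)%E (fun p => ev p.1 (k^-1)%g * Z psi p).
  split.
    apply: cmeasurableM (Z2 _ psi2).1.
    by split; [exact: (measurableT_comp mev.1 measurable_fst)|
               exact: (measurableT_comp mev.2 measurable_fst)].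
  rewrite [X in (X < _)%E](_ : _ = sqnorm (P \x nu)%E (Z psi)).
    exact: (Z2 _ psi2).2.
  by apply: eq_integral => p _; rewrite cnormM (cnorm_unit (ev_norm _ _)) mul1r.
rewrite -(inner_zak zakZ)//.
rewrite (inner_ae (Z2 _ Epsi2) evZ2 (Z2 _ phi2) (zak_translates hmu zakZ k psi2)).
apply: (inner_bracket0 (chi := fun al => ev al (k^-1)%g)) => //.
- exact: Z2.
- exact: Z2.
- by move=> al; exact: ev_norm.
Qed.

(** * The five assertions on subspace orthogonality *)

Unset Implicit Arguments.

Theorem theorem3p9 (R : realType) (G : topGroupType) (Gam : groupClosed G)
    (mu : {measure set (borel G) -> \bar R})
    (nu : {sigma_finite_measure set (borel (coset_space Gam)) -> \bar R})
    (P : probability (borel (dual R (subgrp Gam))) R)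
    (Xi : coset_space Gam -> G)
    (Z : (G -> R[i]) ->
         borel (dual R (subgrp Gam)) * borel (coset_space Gam) -> R[i])
    (phi psi : G -> R[i]) :
  @second_countable G -> locally_compact [set: G] -> hausdorff_space G ->
  closed_discrete_abelian Gam ->
  left_haar mu -> left_haar P ->
  borel_section Xi -> weil_formula mu nu Xi -> zak_transform mu nu P Xi Z ->
  L2 mu phi -> L2 mu psi ->
  bessel mu (translates Gam phi) -> bessel mu (translates Gam psi) ->
  let E := translates Gam in
  let S := fun f => closed_span mu (E f) in
  let br := fun f g => bracket nu (Z f) (Z g) in
  [/\ (* (i) *)
      {ae P, forall al, br phi phi al * br psi psi al = 0} ->
        {ae P, forall al, br phi psi al = 0} /\
        subspace_orthogonal mu (S phi) (E psi) (E phi),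
      (* (ii) *)
      subspace_orthogonal mu (S phi) (E psi) (E phi) ->
        forall psi', S psi psi' ->
          annihilates mu (S phi) (E phi) (E psi') /\
          (bessel mu (E psi') ->
             subspace_orthogonal mu (S phi) (E psi') (E phi)),
      (* (iii) *)
      S psi = S phi -> subspace_orthogonal mu (S phi) (E psi) (E phi) ->
        subspace_orthogonal mu (S phi) (E phi) (E psi) /\
        orthogonal_pair mu (E psi) (E phi),
      (* (iv) *)
      S psi = S phi ->
        (orthogonal_pair mu (E psi) (E phi) <->
         {ae P, forall al, br phi phi al * br psi psi al = 0}) &
      (* (v) *)
      P.-negligible (zak_supp nu (Z phi) `&` zak_supp nu (Z psi)) ->
        subspace_orthogonal mu (S phi) (E psi) (E phi)].
Proof.
move=> _ _ _ [_ _ comm] hmu _ _ _ zakZ phi2 psi2 Bphi Bpsi E S br.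
have [Z2 _ Ziso _ _] := zakZ.
have Zphi2 := Z2 _ phi2; have Zpsi2 := Z2 _ psi2.
(* The common entry point for (i) and (v): the product of brackets and the supports both translate
   into this alternative on fibres. *)
have fibres0 : {ae P, forall al, {ae nu, forall q, Z phi (al, q) = 0} \/
      {ae nu, forall q, Z psi (al, q) = 0}} ->
    {ae P, forall al, br phi psi al = 0}.
  apply: filterS => al [phi0|psi0].
    by apply: bracket_ae0l phi0; [exact: Zphi2.1|exact: Zpsi2.1].
  by apply: bracket_ae0r psi0; [exact: Zphi2.1|exact: Zpsi2.1].
have ortho_ann : (forall k, inner mu phi (E psi k) = 0) ->
    subspace_orthogonal mu (S phi) (E psi) (E phi).
  move=> ortho; split => //; apply: annihilates_ortho => f k Sf.
  apply: (inner_closed_span0 hmu phi2 psi2 ortho) => //.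
  exact: mem_closed_span.
have i : {ae P, forall al, br phi phi al * br psi psi al = 0} ->
    {ae P, forall al, br phi psi al = 0} /\
    subspace_orthogonal mu (S phi) (E psi) (E phi).
  move=> prod0; have br0 : {ae P, forall al, br phi psi al = 0}.
    apply: fibres0.
    move: prod0 (bracket_self_eq0 Zphi2) (bracket_self_eq0 Zpsi2).
    apply: filterS3 => al /eqP; rewrite mulf_eq0 => /orP[/eqP + p _|/eqP + _ p].
      by move/p; left.
    by move/p; right.
  split => //; apply: ortho_ann => k.
  exact: inner_translates_bracket0 hmu zakZ phi2 psi2 br0.
(* Once the two spans coincide, their mutual orthogonality makes [S phi] orthogonal to itself, hence
   to both systems of translates. *)
have self0 : S psi = S phi -> (forall k, inner mu phi (E psi k) = 0) ->
    (forall f k, S phi f -> inner mu f (E phi k) = 0) /\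
    (forall f k, S phi f -> inner mu f (E psi k) = 0).
  move=> SS ortho; split=> f k Sf.
    apply: (inner_closed_span0 hmu phi2 psi2 ortho) => //.
    by rewrite -/(S psi) SS; exact: mem_closed_span.
  apply: (inner_closed_span0 hmu phi2 psi2 ortho) => //.
  exact: mem_closed_span.
have coef0 : subspace_orthogonal mu (S phi) (E psi) (E phi) ->
    forall k, inner mu phi (E psi k) = 0.
  (* Annihilation is applied to the vector [phi], a member of its own closed span. *)
  move=> [_ ann]; apply: synthesis0_coef0 => //.
  by apply: ann; exact: mem_closed_span.
split.
- exact: i.
- move=> /coef0 ortho psi' Spsi'.
  have ann : annihilates mu (S phi) (E phi) (E psi').
    apply: annihilates_ortho => f k Sf.
    exact: (inner_closed_span0 hmu phi2 psi2 ortho k Sf Spsi').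
  by split.
- move=> SS /coef0 /(self0 SS)[phi0 psi0].
  have ann : annihilates mu (S phi) (E psi) (E phi).
    exact: annihilates_ortho.
  by split; split => //; rewrite -/(S psi) SS.
- move=> SS; split=> [[_ _ _ ann]|/i[_ /coef0 /(self0 SS)[phi0 _]]].
    (* The pair is given as [E psi], [E phi], so [phi] and [psi] exchange roles in
       [synthesis0_coef0]. As [psi] also lies in [S phi], it is orthogonal to itself; so [Z psi] has
       norm 0 and its bracket with itself vanishes almost everywhere. *)
    have ortho k : inner mu psi (E phi k) = 0.
      by apply: synthesis0_coef0 k => //; apply: ann; exact: mem_closed_span.
    have psi0 : inner mu psi (E psi 1%g) = 0.
      apply: (inner_closed_span0 hmu psi2 phi2 ortho).
        exact: mem_closed_span.
      by rewrite -/(S phi) -SS; exact: mem_closed_span.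
    have Zpsi0 : sqnorm (P \x nu)%E (Z psi) = 0%E.
      by move: psi0; rewrite /E translates1 Ziso// -inner_self// => ->.
    apply: filterS (bracket_self_ae0 Zpsi2 Zpsi0) => al psi_al.
    by rewrite /br psi_al mulr0.
  by split => //; apply: annihilates_ortho => f k Sf; apply: phi0; rewrite -SS.
- move=> neg; apply: ortho_ann => k.
  apply: inner_translates_bracket0 hmu zakZ phi2 psi2 _; apply: fibres0.
  (* By De Morgan, where the alternative of [fibres0] fails, [al] lies in both supports. *)
  by apply: negligibleS neg => al /= /not_orP[].
Qed.
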